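(* Let $P=(X,\prec)$ be a finite partial order, let $k\ge 1$ be an integer, and fix a real number $\epsilon$ with $0<\epsilon<\frac{1}{2|X|}$. Let $G_{P,k}$ be the weighted digraph with vertex set $\{\ell_x, r_x : x\in X\}$ (all $2|X|$ vertices distinct) and the following arcs: \begin{itemize} \item $(\ell_y, r_x)$ with weight $-\epsilon$ for all $x,y\in X$ with $x\prec y$; \item $(r_x,\ell_y)$ with weight $0$ for all $x,y\in X$ with $x\parallel y$ (i.e. $x$ and $y$ incomparable); \item $(r_x,\ell_x)$ with weight $-1$ for all $x\in X$; \item $(\ell_x,r_x)$ with weight $k$ for all $x\in X$. \end{itemize} Then the following are equivalent: \begin{enumerate} \item $P$ has a $[1,k]$-interval representation. \item $P$ contains no induced $\mathbf{2+2}$ and no induced $\mathbf{(k+2)+1}$. \item The weighted digraph $G_{P,k}$ contains no negative cycle. \end{enumerate}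
   Context: A poset $P=(X,\prec)$ consists of a set $X$ with an irreflexive, transitive relation $\prec$; $x\parallel y$ means $x\ne y$ are incomparable (neither $x\prec y$ nor $y\prec x$). An interval representation of $P$ assigns to each $x\in X$ a closed real interval $I_x=[L(x),R(x)]$ such that $x\prec y$ if and only if $I_x$ lies completely to the left of $I_y$ (i.e. $R(x)<L(y)$). $P$ has a $[1,k]$-interval representation if it has an interval representation in which every interval length $R(x)-L(x)$ lies in $[1,k]$. The poset $\mathbf{2+2}$ has four elements $a,b,x,y$ whose only comparabilities are $a\prec x$ and $b\prec y$. The poset $\mathbf{n+1}$ consists of a chain $a_1\prec a_2\prec\cdots\prec a_n$ of $n$ distinct elements together with one further element incomparable to every $a_i$. ''$P$ contains an induced $Q$'' means some subset of $X$ with the restriction of $\prec$ is isomorphic to $Q$. In a weighted digraph, a cycle is a subgraph with distinct vertices $x_1,\dots,x_t$ and arcs $(x_i,x_{i+1})$ for $1\le i\le t-1$ together with $(x_t,x_1)$; its weight is the sum of its arc weights, and a negative cycle is a cycle of negative weight. *)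

(* Defs.v *)
From HB Require Import structures.
From mathcomp Require Import all_boot all_order all_algebra.
From mathcomp Require Import reals.

Set Implicit Arguments.
Unset Strict Implicit.
Unset Printing Implicit Defensive.

Import Order.TTheory GRing.Theory Num.Theory.
Local Open Scope ring_scope.

Fact dsum_display : Order.disp_t. Proof. exact: (Order.Disp tt tt). Qed.

(* The "+" of posets in [2+2] and [n+1]: two elements from different summands
   are incomparable. *)
Definition dsum (A B : Type) : Type := (A + B)%type.

Section DisjointSum.
Context (dA dB : Order.disp_t) (A : finPOrderType dA) (B : finPOrderType dB).

HB.instance Definition _ := Finite.copy (dsum A B) (A + B)%type.

Definition dsum_lt (u v : dsum A B) : bool :=
  match u, v with
  | inl a, inl a' => (a < a')%O
  | inr b, inr b' => (b < b')%O
  | _, _ => false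
  end.

Fact dsum_lt_irr : irreflexive dsum_lt.
Proof. by case=> x /=; rewrite ltxx. Qed.

Fact dsum_lt_trans : transitive dsum_lt.
Proof. by case=> y [] x [] z //=; apply: lt_trans. Qed.

HB.instance Definition _ :=
  Order.Lt_isPOrder.Build dsum_display (dsum A B) dsum_lt_irr dsum_lt_trans.
End DisjointSum.

(* ['I_n] carries its canonical linear order, i.e. it is the n-element chain. *)
Definition two_plus_two : finPOrderType dsum_display := dsum 'I_2 'I_2.
Definition n_plus_one (n : nat) : finPOrderType dsum_display := dsum 'I_n 'I_1.

Definition contains_induced (dP dQ : Order.disp_t)
    (P : finPOrderType dP) (Q : finPOrderType dQ) : Prop :=
  exists (A : {set P}) (f : Q -> {x : P | x \in A}),
    bijective f /\ forall u v : Q, (val (f u) < val (f v))%O = (u < v)%O.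

Definition interval_representation (R : realType) (d : Order.disp_t)
    (P : finPOrderType d) (lo hi : P -> R) : Prop :=
  (forall x, lo x <= hi x) /\
  (forall x y : P, (x < y)%O <-> hi x < lo y).

Definition has_1k_interval_representation (R : realType) (d : Order.disp_t)
    (P : finPOrderType d) (k : nat) : Prop :=
  exists lo hi : P -> R,
    interval_representation lo hi /\
    forall x, 1 <= hi x - lo x <= k%:R.

(* [wdarc u v = Some w] means that (u, v) is an arc, of weight w. *)
Record wdigraph (R : realType) := WDigraph {
  wdvertex : finType;
  wdarc : wdvertex -> wdvertex -> option R }.

Definition is_arc (R : realType) (G : wdigraph R) : rel (wdvertex G) :=
  fun u v => isSome (wdarc u v).

Definition arc_weight (R : realType) (G : wdigraph R) (u v : wdvertex G) : R :=
  odflt 0 (wdarc u v).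

Definition is_cycle (R : realType) (G : wdigraph R)
    (c : seq (wdvertex G)) : Prop :=
  c <> [::] /\ ucycle (@is_arc R G) c.

Definition cycle_weight (R : realType) (G : wdigraph R)
    (c : seq (wdvertex G)) : R :=
  \sum_(v <- c) arc_weight v (next c v).

Definition has_negative_cycle (R : realType) (G : wdigraph R) : Prop :=
  exists c : seq (wdvertex G), is_cycle c /\ cycle_weight c < 0.

(* The vertex l_x is [inl x] and r_x is [inr x]. The four families of arcs have
   pairwise distinct endpoints, so each arc has a single weight. *)
Definition GPk_arc (R : realType) (d : Order.disp_t) (P : finPOrderType d)
    (k : nat) (eps : R) (u v : (P + P)%type) : option R :=
  match u, v with
  | inl y, inr x =>
      if (x < y)%O then Some (- eps) else if x == y then Some k%:R else None
  | inr x, inl y =>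
      if (x >< y)%O then Some 0 else if x == y then Some (- 1) else None
  | _, _ => None
  end.

Definition GPk (R : realType) (d : Order.disp_t) (P : finPOrderType d)
    (k : nat) (eps : R) : wdigraph R :=
  WDigraph (@GPk_arc R d P k eps).

(* Main.v *)
(** A [[1,k]]-representation is a potential on [G_{P,k}], so the absence of
    negative cycles yields one: take the least weight of a simple path ending
    at each vertex. That a representation excludes [2+2] and [(k+2)+1] is a
    direct computation with endpoints.

    The remaining point is that a negative cycle produces one of the two
    forbidden posets. As [eps < 1 / (2 |P|)], dropping the [eps]'s from a
    negative cycle leaves an integer weight [<= 0]; start the cycle at a vertex
    where the partial sums of integer weights are maximal, so that all partial
    sums from there on are [<= 0]. Unless the cycle has length two, this vertex
    can be taken to be some [l_u]. Let [D x] be the set of elements below [x];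
    without [2+2] these sets are linearly ordered by inclusion. Reaching [l_v]
    with integer weight [- n] then gives a chain [u > c_1 > ... > c_n] with
    [v = c_n] or [D v] strictly inside [D c_n], and reaching [r_x] gives such a
    chain with [x < c_n]: an arc of weight [k] from [l_v] to [r_v] discards the
    last [k] links of the chain, and [v] lies below the new end because
    otherwise those links, extended by an element of [D c_n] outside [D v],
    form a [(k+2)+1] with [v]. Closing the cycle means an arc from some [r_x]
    with [x < u] to [l_u], which does not exist. *)
Require Import Defs.
From mathcomp Require Import all_boot all_order all_algebra.
From mathcomp Require Import reals zify lra.
Import Order.TTheory GRing.Theory Num.Theory.
Set Implicit Arguments.
Unset Strict Implicit.
Unset Printing Implicit Defensive.
Local Open Scope ring_scope.

(** * Forbidden posets as order embeddings *)

Lemma contains_inducedP (dP dQ : Order.disp_t) (P : finPOrderType dP)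
    (Q : finPOrderType dQ) :
  contains_induced P Q <->
  exists g : Q -> P, injective g /\ {mono g : u v / (u < v)%O}.
Proof.
split=> [[A [f [bij_f mono_f]]]|[g [inj_g mono_g]]].
  exists (fun u => val (f u)); split=> [u v /val_inj|]; last exact: mono_f.
  exact: bij_inj.
have gA u : g u \in g @: [set: Q] by rewrite imset_f ?inE.
exists (g @: [set: Q]), (fun u => exist _ (g u) (gA u)); split=> //.
apply: inj_card_bij => [u v /(congr1 val)/inj_g //|].
by rewrite card_sig (card_imset _ inj_g) cardsT.
Qed.

Lemma two_plus_two_freeP (d : Order.disp_t) (P : finPOrderType d) :
  ~ contains_induced P two_plus_two ->
  forall a x b y : P, (a < x)%O -> (b < y)%O -> (a < y)%O || (b < x)%O.
Proof.
move=> free a x b y ax by_; case: (boolP (a < y)%O) => //= nay.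
case: (boolP (b < x)%O) => // nbx; case: free; apply/contains_inducedP.
pose g (u : two_plus_two) : P :=
  match u with
  | inl i => if i == 0 :> 'I_2 then a else x
  | inr i => if i == 0 :> 'I_2 then b else y
  end.
have nab : (a < b)%O = false.
  by apply: contraNF nay => /lt_trans; apply.
have nba : (b < a)%O = false.
  by apply: contraNF nbx => /lt_trans; apply.
have nxy : (x < y)%O = false.
  by apply: contraNF nay => /(lt_trans ax).
have nyx : (y < x)%O = false.
  by apply: contraNF nbx => /(lt_trans by_).
have nxb : (x < b)%O = false.
  by apply: contraFF nab => /(lt_trans ax).
have nya : (y < a)%O = false.
  by apply: contraFF nba => /(lt_trans by_).
have cases (i : 'I_2) : i = 0 \/ i = 1.
  by case: i => [[|[|//]] ?]; [left|right]; apply: val_inj.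
exists g; split.
  move=> [i|i] [j|j]; case: (cases i) => ->; case: (cases j) => -> //= e;
    move: ax by_ nay nbx nab nba nxy nyx nxb nya; rewrite e ?ltxx //;
    by do !case: (_ < _)%O.
move=> [i|i] [j|j]; case: (cases i) => ->; case: (cases j) => -> /=;
  rewrite ?ltxx ?ax ?by_ ?nab ?nba ?nxy ?nyx ?nxb ?nya //;
  rewrite ?(negPf nay) ?(negPf nbx) //;
  by rewrite ?(lt_gtF ax) ?(lt_gtF by_).
Qed.

Lemma induced_n_plus_one (d : Order.disp_t) (P : finPOrderType d)
    (s : seq P) (b : P) :
  sorted <%O s -> {in s, forall a, a >< b}%O ->
  contains_induced P (n_plus_one (size s)).
Proof.
move=> sorted_s inc; apply/contains_inducedP.
pose g (u : n_plus_one (size s)) : P :=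
  match u with inl i => nth b s i | inr _ => b end.
have nthb (i : 'I_(size s)) : (nth b s i >< b)%O by rewrite inc ?mem_nth.
exists g; split.
  move=> [i|i] [j|j] //=.
  - by move/eqP; rewrite nth_uniq ?lt_sorted_uniq // => /eqP/val_inj ->.
  - by move=> e; move: (nthb i); rewrite e comparablexx.
  - by move=> e; move: (nthb j); rewrite -e comparablexx.
  - by rewrite !ord1.
move=> [i|i] [j|j] //=.
- by rewrite (lt_sorted_ltn_nth b sorted_s) ?inE.
- by apply: contraNF (nthb i) => /lt_comparable.
- by apply: contraNF (nthb j) => /gt_comparable.
- by rewrite ltxx !ord1 ltxx.
Qed.

(** * Interval representations exclude the forbidden posets *)

Lemma interval_representation_no_two_plus_two (R : realType)
    (d : Order.disp_t) (P : finPOrderType d) (lo hi : P -> R) :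
  interval_representation lo hi -> ~ contains_induced P two_plus_two.
Proof.
move=> [_ repr] /contains_inducedP[g [_ mono_g]].
have /repr ax : (g (inl 0) < g (inl 1))%O by rewrite mono_g.
have /repr by_ : (g (inr 0) < g (inr 1))%O by rewrite mono_g.
have nay : ~ (g (inl 0) < g (inr 1))%O by rewrite mono_g.
have nbx : ~ (g (inr 0) < g (inl 1))%O by rewrite mono_g.
case: (ltP (hi (g (inl 0))) (lo (g (inr 1)))) => [/repr //|].
case: (ltP (hi (g (inr 0))) (lo (g (inl 1)))) => [/repr //|].
by lra.
Qed.

Lemma interval_representation_no_n_plus_one (R : realType)
    (d : Order.disp_t) (P : finPOrderType d) (lo hi : P -> R) (k : nat) :
  interval_representation lo hi ->
  (forall x, 1 <= hi x - lo x <= k%:R) ->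
  ~ contains_induced P (n_plus_one k.+2).
Proof.
move=> [_ repr] len /contains_inducedP[g [_ mono_g]].
pose a n : P := g (inl (inord n)).
have chain n : (n <= k)%N -> hi (a n) < lo (a n.+1).
  move=> nk; apply/repr; rewrite mono_g.
  by rewrite /Order.lt /= ltEord !inordK //; lia.
(* Each inner interval of the chain has length at least 1. An element incomparable to the whole
   chain meets both end intervals, so at [n = k] it would be longer than [k]. *)
have grow n : (n <= k)%N -> hi (a 0) + n%:R < lo (a n.+1).
  elim: n => [|n IH] nk; first by rewrite addr0 chain.
  have := chain _ nk; have := IH (ltnW nk); have := len (a n.+1).
  by rewrite -natr1; lra.
have nab : ~ (a 0 < g (inr 0))%O by rewrite mono_g.
have nba : ~ (g (inr 0) < a k.+1)%O by rewrite mono_g.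
case: (ltP (hi (a 0)) (lo (g (inr 0)))) => [/repr //|].
case: (ltP (hi (g (inr 0))) (lo (a k.+1))) => [/repr //|].
by have := grow _ (leqnn k); have := len (g (inr 0)); lra.
Qed.

(** The arcs of weight [k] and [-1] bound the lengths, those of weight [- eps] separate comparable
    intervals strictly, and those of weight [0] make incomparable ones meet. *)
Lemma GPk_potential_representation (R : realType) (d : Order.disp_t)
    (P : finPOrderType d) (k : nat) (eps : R) (f : wdvertex (GPk P k eps) -> R) :
  0 < eps ->
  (forall u v, is_arc u v -> f v <= f u + arc_weight u v) ->
  has_1k_interval_representation R P k.
Proof.
move=> eps_gt0 fP; exists (fun x => f (inl x)), (fun x => f (inr x)).
have len x : 1 <= f (inr x) - f (inl x) <= k%:R.
  have := fP (inl x) (inr x); have := fP (inr x) (inl x).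
  rewrite /is_arc /arc_weight /= comparablexx ltxx eqxx /=.
  by move=> /(_ isT) ? /(_ isT) ?; lra.
have ltP x y : (x < y)%O -> f (inr x) < f (inl y).
  move=> xy; have := fP (inl y) (inr x).
  by rewrite /is_arc /arc_weight /= xy /= => /(_ isT); lra.
split=> //; split=> [x|x y]; first by have := len x; lra.
split=> [/ltP //|]; have := len x; have := len y.
case: (comparableP x y) => //.
- by move=> /ltP; lra.
- move=> xy; have := fP (inr x) (inl y).
  rewrite /is_arc /arc_weight /= xy /= => /(_ isT); lra.
- by move=> ->; lra.
Qed.

(** * Path and cycle weights, and shortest-path potentials *)

Lemma next_nth_mod (T : eqType) (x0 : T) (c : seq T) (i : nat) :
  uniq c -> (0 < size c)%N ->
  next c (nth x0 c (i %% size c)) = nth x0 c (i.+1 %% size c).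
Proof.
case: c => [//|y p] uniq_c size_gt0; have i_lt := ltn_pmod i size_gt0.
rewrite next_nth mem_nth // index_uniq //.
rewrite -[i.+1]addn1 -modnDml addn1 /=.
move: (i %% _)%N i_lt => j; rewrite ltnS leq_eqVlt => /predU1P[->|j_lt].
  by rewrite nth_default // modnn.
by rewrite modn_small ?ltnS //=; apply: set_nth_default.
Qed.

Lemma cycle_weight_nth (R : realType) (G : wdigraph R) (x0 : wdvertex G)
    (c : seq (wdvertex G)) : uniq c ->
  cycle_weight c = \sum_(0 <= i < size c)
    arc_weight (nth x0 c (i %% size c)) (nth x0 c (i.+1 %% size c)).
Proof.
move=> uniq_c; rewrite /cycle_weight (big_nth x0) !big_nat.
apply: eq_bigr => i /andP[_ i_lt]; rewrite -next_nth_mod //.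
  by rewrite modn_small.
exact: leq_ltn_trans i_lt.
Qed.

Fixpoint path_weight (R : realType) (G : wdigraph R) (x : wdvertex G)
    (p : seq (wdvertex G)) : R :=
  if p is y :: p' then arc_weight x y + path_weight y p' else 0.

Lemma path_weight_cat (R : realType) (G : wdigraph R) (x : wdvertex G)
    (p q : seq (wdvertex G)) :
  path_weight x (p ++ q) = path_weight x p + path_weight (last x p) q.
Proof. by elim: p x => [|y p IH] x /=; rewrite ?add0r // IH addrA. Qed.

Lemma path_weight_nth (R : realType) (G : wdigraph R) (x x0 : wdvertex G)
    (p : seq (wdvertex G)) :
  path_weight x p =
  \sum_(0 <= i < size p) arc_weight (nth x0 (x :: p) i) (nth x0 p i).
Proof.
elim: p x => [|y p IH] x /=; first by rewrite big_geq.
by rewrite big_nat_recl //= IH.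
Qed.

Lemma cycle_weight_path (R : realType) (G : wdigraph R) (x : wdvertex G)
    (p : seq (wdvertex G)) : uniq (x :: p) ->
  cycle_weight (x :: p) = path_weight x (rcons p x).
Proof.
move=> uniq_p; rewrite (cycle_weight_nth x uniq_p) (path_weight_nth _ x).
rewrite size_rcons !big_nat; apply: eq_bigr => i /andP[_ i_lt].
rewrite /= modn_small //; congr arc_weight.
  by rewrite -rcons_cons nth_rcons /= i_lt.
move: i_lt; rewrite ltnS nth_rcons leq_eqVlt => /predU1P[->|i_lt].
  by rewrite modnn ltnn eqxx.
by rewrite modn_small ?ltnS //= i_lt.
Qed.

(* The potential of v is the least weight of a simple path ending at v, encoded
   as the sequence of its vertices; the default value 0 of the minimum is the
   weight of the one-vertex path. *)
Lemma no_negative_cycle_potential (R : realType) (G : wdigraph R) :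
  ~ has_negative_cycle G ->
  exists f : wdvertex G -> R,
    forall u v, is_arc u v -> f v <= f u + arc_weight u v.
Proof.
move=> noneg; pose V := wdvertex G.
pose simple (v : V) (s : seq V) :=
  if s is x :: p then [&& path (@is_arc R G) x p, uniq s & last x p == v]
  else false.
pose weight (s : seq V) := if s is x :: p then path_weight x p else 0.
pose f v := \big[Order.min/0]_(s : #|V|.-bseq V | simple v s) weight s.
have f_le v s : simple v s -> f v <= weight s.
  move=> s_ok; have size_s : (size s <= #|V|)%N.
    case: s s_ok => [//|x p] /and3P[_ uniq_p _].
    by rewrite -(card_uniqP uniq_p) max_card.
  by have := @bigmin_le_cond _ _ _ 0 (Bseq size_s) (fun s => simple v s)
       (fun s => weight s) s_ok.
exists f => u v uv; rewrite -lerBlDr; apply/bigmin_geP.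
suff main s : simple u s -> f v - arc_weight u v <= weight s.
  split; last by move=> s; apply: main.
  by have := main [:: u]; rewrite /simple /= eqxx => /(_ isT).
case: s => [//|x p] /and3P[xp uniq_xp /eqP last_p].
(* If [v] is off the path, append it. Otherwise cut the path at [v]: the tail closes through the arc
   from [u] to a cycle of nonnegative weight, so the head is light enough. *)
rewrite lerBlDr; case: (boolP (v \in x :: p)) => v_in; last first.
  suff /f_le : simple v (x :: rcons p v).
    by rewrite /weight /= -cats1 path_weight_cat last_p /= addr0.
  apply/and3P; rewrite rcons_path xp last_p uv last_rcons; split=> //.
  by rewrite -rcons_cons rcons_uniq v_in.
have {v_in} [p1 [p2 [px ep lp]]] : exists p1 p2,
    [/\ p = p1 ++ p2, last x p1 = v & uniq (v :: p2)].
  move: v_in; rewrite inE => /predU1P[->|/splitPr v_in].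
    by exists [::], p.
  case: v_in uniq_xp => p1 p2 uniq_xp; exists (rcons p1 v), p2.
  rewrite cat_rcons last_rcons; split=> //.
  by move: uniq_xp; rewrite -cat_cons cat_uniq => /and3P[].
move: xp last_p uniq_xp; rewrite px /weight path_weight_cat last_cat ep cat_path ep.
move=> /andP[xp1 vp2] last_p; rewrite -cat_cons cat_uniq => /andP[uniq_p1 _].
have : ~~ (cycle_weight (v :: p2) < 0).
  apply/negP => neg; apply: noneg; exists (v :: p2); split=> //; split=> //.
  by rewrite /ucycle /ucycleb lp /= rcons_path vp2 last_p uv.
rewrite -leNgt cycle_weight_path // -cats1 path_weight_cat /= addr0 last_p.
have /f_le : simple v (x :: p1) by rewrite /simple xp1 uniq_p1 ep eqxx.
by rewrite /weight; lra.
Qed.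

(** * Down sets and descending chains *)

Definition down (d : Order.disp_t) (P : finPOrderType d) (x : P) : {set P} :=
  [set a | (a < x)%O].

Lemma down_proper (d : Order.disp_t) (P : finPOrderType d) (a x y : P) :
  ~ contains_induced P two_plus_two ->
  (a < y)%O -> ~~ (a < x)%O -> down x \proper down y.
Proof.
move=> /two_plus_two_freeP free ay nax; apply/properP; split; last first.
  by exists a; rewrite inE.
apply/subsetP => b; rewrite !inE => bx.
by have := free _ _ _ _ bx ay; rewrite (negPf nax) orbF.
Qed.

Lemma path_gt_last (d : Order.disp_t) (P : porderType d) (y : P) (c : seq P) :
  path >%O y c -> (last y c <= y)%O.
Proof.
elim: c y => [|z c IH] y //= /andP[yz /IH zc].
exact: le_trans zc (ltW yz).
Qed.

(** Proper inclusion provides an element below [y] but not below [v], which extends the chain in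
    [long_chain_above]. *)
Definition start_below (d : Order.disp_t) (P : finPOrderType d) (y v : P) :=
  (y == v) || (down v \proper down y).

Lemma start_below_downS (d : Order.disp_t) (P : finPOrderType d) (y v : P) :
  start_below y v -> down v \subset down y.
Proof. by case/predU1P => [->|/proper_sub]. Qed.

Lemma long_chain_above (d : Order.disp_t) (P : finPOrderType d) (y v : P)
    (c : seq P) :
  ~ contains_induced P (n_plus_one (size c).+2) -> (0 < size c)%N ->
  path >%O y c -> start_below (last y c) v -> (v < y)%O.
Proof.
move=> free c_gt0 yc /predU1P[<-|/properP[_ [x]]].
  case: c c_gt0 yc {free} => //= z c _ /andP[zy /path_gt_last].
  by move=> /le_lt_trans; apply.
rewrite !inE => xc nxv; case: (boolP (v < y)%O) => // nvy; case: free.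
pose s := x :: rev (y :: c).
have sorted_s : sorted <%O s.
  have -> : s = rev (y :: rcons c x) by rewrite /s -rev_rcons.
  by rewrite rev_sorted /= rcons_path; apply/andP; split.
have -> : (size c).+2 = size s by rewrite /= size_rev.
apply: (@induced_n_plus_one _ _ s v) => // a a_in.
have xa : (x <= a)%O.
  move: a_in; rewrite inE => /predU1P[->//|a_in].
  exact: ltW (allP (order_path_min lt_trans sorted_s) _ a_in).
have ay : (a <= y)%O.
  move: a_in; rewrite inE mem_rev inE => /or3P[/eqP->|/eqP->//|a_in].
    exact: ltW (lt_le_trans xc (path_gt_last yc)).
  have gt_trans : transitive (>%O : rel P).
    by move=> ? ? ? h1 h2; apply: lt_trans h2 h1.
  exact: ltW (allP (order_path_min gt_trans yc) _ a_in).
(* As [x <= a <= y], comparability of [a] and [v] forces [x = v] or [v = y]; either contradicts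
   [x < y]. *)
apply/negP => /orP[av|va].
  have : (x <= v)%O by apply: le_trans av.
  rewrite le_eqVlt (negPf nxv) orbF => /eqP e; subst x.
  by move: nvy; rewrite (lt_le_trans xc (path_gt_last yc)).
have : (v <= y)%O by apply: le_trans ay.
rewrite le_eqVlt (negPf nvy) orbF => /eqP e; subst v.
by move: nxv; rewrite (lt_le_trans xc (path_gt_last yc)).
Qed.

(** * Integer weights and the chain invariant *)

(* The weight of an arc with its [- eps] dropped. *)
Definition GPk_int (d : Order.disp_t) (P : finPOrderType d) (k : nat)
    (u v : (P + P)%type) : int :=
  match u, v with
  | inl y, inr x => if (x < y)%O then 0 else k%:Z
  | inr x, inl y => if (x >< y)%O then 0 else - 1
  | _, _ => 0
  end.

Lemma arc_weight_GPk_int (R : realType) (d : Order.disp_t)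
    (P : finPOrderType d) (k : nat) (eps : R) (u v : wdvertex (GPk P k eps)) :
  0 < eps -> is_arc u v -> (GPk_int k u v)%:~R - eps <= arc_weight u v.
Proof.
move=> eps_gt0; rewrite /is_arc /arc_weight.
by case: u v => [y|x] [x'|y'] //=; do !case: ifP => _ //=;
  rewrite ?mulrNz ?mulr1z ?mulr0z -?pmulrn => _; lra.
Qed.

(* Invariant of a walk from l_u to [w] of integer weight [- n] whose initial
   parts all have nonpositive integer weight. *)
Definition chain_to (d : Order.disp_t) (P : finPOrderType d) (u : P) (n : int)
    (w : (P + P)%type) : Prop :=
  exists c : seq P, [/\ path >%O u c, (size c)%:Z = n &
    match w with
    | inl v => start_below (last u c) v
    | inr x => (x < last u c)%O
    end].

Lemma chain_to_arc (R : realType) (d : Order.disp_t) (P : finPOrderType d)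
    (k : nat) (eps : R) (u : P) (n : int) (a b : wdvertex (GPk P k eps)) :
  (1 <= k)%N ->
  ~ contains_induced P two_plus_two -> ~ contains_induced P (n_plus_one k.+2) ->
  is_arc a b -> 0 <= n - GPk_int k a b ->
  chain_to u n a -> chain_to u (n - GPk_int k a b) b.
Proof.
move=> k_gt0 free2 freek; rewrite /is_arc.
case: a b => [y|x] [x'|y'] //=; case: ifP => [h|h] //=; rewrite ?subr0 ?opprK.
- move=> _ _ [c [uc <- yc]]; exists c; split=> //.
  by have := subsetP (start_below_downS yc) y'; rewrite !inE; apply.
- case: ifP => // /eqP -> _ n_ge [c [uc cn yc]].
  (* Nonpositivity of the new partial sum guarantees [k] links to discard. *)
  have k_le : (k <= size c)%N by lia.
  move: uc yc cn; rewrite -(cat_take_drop (size c - k) c).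
  set c1 := take _ c; set c2 := drop _ c => uc yc cn.
  have c2k : size c2 = k by rewrite size_drop; lia.
  move: uc yc cn; rewrite cat_path last_cat size_cat => /andP[uc1 uc2] yc cn.
  exists c1; split=> //; first by lia.
  by apply: (long_chain_above _ _ uc2 yc); rewrite c2k.
- move=> _ _ [c [uc <- xc]]; exists c; split=> //.
  rewrite /start_below (down_proper free2 xc) ?orbT //.
  by apply: contraNN h => /lt_comparable.
- case: ifP => // /eqP <- _ _ [c [uc <- xc]]; exists (rcons c x).
  rewrite rcons_path uc size_rcons last_rcons /start_below eqxx; split=> //.
  by lia.
Qed.

Lemma chain_to_return (R : realType) (d : Order.disp_t) (P : finPOrderType d)
    (k : nat) (eps : R) (u : P) (n : int) (a : wdvertex (GPk P k eps)) :
  @is_arc R (GPk P k eps) a (inl u) -> ~ chain_to u n a.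
Proof.
rewrite /is_arc; case: a => [//|x] /= xu [c [uc _ xc]].
have {uc} xltu : (x < u)%O := lt_le_trans xc (path_gt_last uc).
by move: xu; rewrite (lt_comparable xltu) (lt_eqF xltu).
Qed.

(** There are no loops, and a cycle of length two joins [inl x] and [inr x], with weight [k - 1]. *)
Lemma short_cycle_weight_ge0 (R : realType) (d : Order.disp_t)
    (P : finPOrderType d) (k : nat) (eps : R) (c : seq (wdvertex (GPk P k eps))) :
  (1 <= k)%N -> is_cycle c -> (size c <= 2)%N -> 0 <= cycle_weight c.
Proof.
move=> k_gt0 [c_neq0 /andP[arcs uniq_c]].
have k_ge1 : 1 <= k%:R :> R by rewrite ler1n.
case: c c_neq0 arcs uniq_c => [//|a [|b [|//]]] _ arcs uniq_c _.
  by move: arcs; rewrite /is_arc; case: a {uniq_c}.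
rewrite cycle_weight_path //=; move: arcs {uniq_c}.
rewrite /is_arc /arc_weight /= andbT.
case: a b => [y|x] [x'|y'] //=; rewrite ?andbF //.
- case: (comparableP y' y) => //= _ _; lra.
- case: (comparableP x x') => //= _ _; lra.
Qed.

(** The maximum over one period is global, since each further period adds [W <= 0]. *)
Lemma periodic_partial_sum_max (N : nat) (S : nat -> int) (W : int) :
  (0 < N)%N -> W <= 0 -> (forall i, S (i + N)%N = S i + W) ->
  exists m, forall i, S i <= S m.
Proof.
move=> N_gt0 W_le0 SN.
case: (@Order.TotalTheory.arg_maxP _ _ _ (Ordinal N_gt0) xpredT
  (fun i : 'I_N => S i) isT) => m _ m_max.
exists m => i; rewrite (divn_eq i N) addnC.
have -> : S (i %% N + i %/ N * N)%N = S (i %% N)%N + W *+ (i %/ N).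
  elim: (i %/ N)%N => [|q IH]; first by rewrite addn0 addr0.
  by rewrite mulSn [(N + _)%N]addnC addnA SN IH mulrSr addrA.
have := m_max (Ordinal (ltn_pmod i N_gt0)) isT => /= le_m.
by rewrite -[leRHS]addr0 lerD // mulrn_wle0.
Qed.

(** * Excluding negative cycles *)

Lemma free_no_negative_cycle (R : realType) (d : Order.disp_t)
    (P : finPOrderType d) (k : nat) (eps : R) :
  (1 <= k)%N -> 0 < eps -> eps * (2 * #|P|)%:R < 1 ->
  ~ contains_induced P two_plus_two -> ~ contains_induced P (n_plus_one k.+2) ->
  ~ has_negative_cycle (GPk P k eps).
Proof.
move=> k_gt0 eps_gt0 eps_lt free2 freek [c [c_cycle c_neg]].
have [c_neq0 /andP[arcs uniq_c]] := c_cycle.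
have [/(short_cycle_weight_ge0 k_gt0 c_cycle)|N_gt2] := leqP (size c) 2.
  by rewrite leNgt c_neg.
have N_gt0 : (0 < size c)%N by apply: leq_trans N_gt2.
have x0 : wdvertex (GPk P k eps) by case: (c) c_neq0 => [[]|x _ _] //; exact: x.
pose v i := nth x0 c (i %% size c).
have v_arc i : is_arc (v i) (v i.+1).
  by rewrite /v -next_nth_mod // next_cycle // mem_nth // ltn_pmod.
have vN i : v (i + size c)%N = v i by rewrite /v modnDr.
pose S i : int := \sum_(0 <= j < i) GPk_int k (v j) (v j.+1).
have SS i : S i.+1 = S i + GPk_int k (v i) (v i.+1).
  by rewrite /S big_nat_recr.
have SN i : S (i + size c)%N = S i + S (size c).
  elim: i => [|i IH]; first by rewrite add0n [S 0%N]big_geq ?add0r.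
  by rewrite addSn !SS IH -addSn !vN addrAC.
(* The dropped [eps]'s total less than 1 because the cycle has at most [2 * #|P|] vertices; an
   integer below 1 is at most 0. *)
have W_le0 : S (size c) <= 0.
  have : (S (size c))%:~R - eps *+ size c <= cycle_weight c.
    rewrite (cycle_weight_nth x0) // rmorph_sum /= -[X in _ *+ X]subn0.
    rewrite -sumr_const_nat -sumrB; apply: ler_sum => i _.
    exact: arc_weight_GPk_int.
  have : eps *+ size c <= eps * (2 * #|P|)%:R.
    rewrite mulr_natr ler_pMn2l // -(card_uniqP uniq_c).
    by rewrite (leq_trans (max_card _)) // card_sum mul2n addnn.
  move=> le_eps ge_w; rewrite leNgt; apply/negP; rewrite gtz0_ge1 => W_ge1.
  have : 1 <= (S (size c))%:~R :> R by rewrite ler1z.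
  by lra.
have start s u : v s = inl u -> ~ (forall i, (s <= i)%N -> S i <= S s).
  move=> vs S_le.
  have chain j : chain_to u (S s - S (s + j)%N) (v (s + j)%N).
    elim: j => [|j IH].
      by rewrite addn0 subrr vs; exists [::]; rewrite /start_below eqxx.
    have := chain_to_arc k_gt0 free2 freek (v_arc (s + j)%N) _ IH.
    rewrite addnS SS opprD addrA; apply.
    by have := S_le (s + j.+1)%N (leq_addr _ _); rewrite addnS SS; lia.
  apply: (chain_to_return _ (chain (size c).-1)).
  by have := v_arc (s + (size c).-1)%N; rewrite -addnS prednK // vN vs.
have [m m_max] := periodic_partial_sum_max N_gt0 W_le0 SN.
case vm: (v m) => [u|x]; first by case: (start m u vm) => i _; apply: m_max.
have := v_arc m; have := SS m; rewrite vm.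
case vm1: (v m.+1) => [z|//] /=; rewrite /is_arc /=.
(* A weight [0] arc out of [inr x] carries the maximum on to [inl z]. Otherwise [z = x], and the arc
   into [inr x] is examined. *)
case: ifP => [_|_].
  by rewrite addr0 => Sm _; case: (start _ _ vm1) => i _; rewrite Sm.
case: ifP => // /eqP xz Sm _.
(* The predecessor of [m], taken one period later to avoid index [m - 1]. *)
pose t := (m + (size c).-1)%N.
have tN : t.+1 = (m + size c)%N by rewrite /t; lia.
have vt1 : v t.+1 = inr x by rewrite tN vN.
have := v_arc t; have := SS t; rewrite vt1.
case vt: (v t) => [y|//] /=; rewrite /is_arc /=.
case: ifP => [_|_].
  (* [S t] may be below the global maximum, but it bounds all later sums: shift them back by one
     period. *)
  rewrite addr0 tN => St _; apply: (start _ _ vt) => i.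
  rewrite leq_eqVlt => /predU1P[<-//|]; rewrite tN -St SN => ti.
  by rewrite -(subnK (leq_trans (leq_addl _ _) ti)) SN lerD2r.
case: ifP => // /eqP xy _ _.
(* Now [inl x] both precedes and follows [inr x], which forces length two. *)
have /eqP : v t = v m.+1 by rewrite vt vm1 -xy xz.
rewrite nth_uniq ?ltn_pmod //.
have -> : t = (m.+1 + (size c - 2))%N by rewrite /t; lia.
by rewrite -[X in _ == X %[mod _]]addn0 eqn_modDl mod0n modn_small; lia.
Qed.

Theorem theorem2 (R : realType) (d : Order.disp_t) (P : finPOrderType d)
    (k : nat) (eps : R)
    (hk : (1 <= k)%N) (eps_gt0 : 0 < eps)
    (eps_lt : eps * (2 * #|P|)%:R < 1) :
  (has_1k_interval_representation R P k <->
     ~ contains_induced P two_plus_two /\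
     ~ contains_induced P (n_plus_one k.+2)) /\
  (~ contains_induced P two_plus_two /\
   ~ contains_induced P (n_plus_one k.+2) <->
     ~ has_negative_cycle (GPk P k eps)).
Proof.
have repr_free : has_1k_interval_representation R P k ->
    ~ contains_induced P two_plus_two /\ ~ contains_induced P (n_plus_one k.+2).
  move=> [lo [hi [repr len]]]; split.
    exact: interval_representation_no_two_plus_two repr.
  exact: interval_representation_no_n_plus_one repr len.
have free_noneg : ~ contains_induced P two_plus_two /\
    ~ contains_induced P (n_plus_one k.+2) -> ~ has_negative_cycle (GPk P k eps).
  by move=> [free2 freek]; apply: free_no_negative_cycle.
have noneg_repr : ~ has_negative_cycle (GPk P k eps) ->
    has_1k_interval_representation R P k.
  move=> /no_negative_cycle_potential[f fP].
  exact: GPk_potential_representation eps_gt0 fP.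
split; split=> //; first by move/free_noneg/noneg_repr.
by move/noneg_repr/repr_free.
Qed.
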